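(* Let $(X,\mathcal{A},\mu)$ be a measure space with a non-trivial $\sigma$-finite measure $\mu$, and let $(V,\|\cdot\|_V)$ be a Banach function space of functions on $\mathbb{R}_+=(0,\infty)$ (not necessarily rearrangement invariant) on which the Hardy operator $H[f](t)=\frac1t\int_0^t f(s)\,ds$ is defined and bounded. Let $|||f|||_Y=\|f^{**}\|_V$ for measurable $f:X\to\mathbb{R}$, and $Y=\{f:\ |||f|||_Y<\infty\}$. Then $(Y,|||\cdot|||_Y)$ is a (complete) rearrangement invariant Banach function space on $(X,\mathcal{A},\mu)$.
   Context: For measurable $f:X\to\mathbb{R}$, the tail function is $T_f(t)=\mu\{x:|f(x)|\ge t\}$, $t\ge 0$; $f^*(t)=T_f^{-1}(t)$ is the left inverse of $T_f$ (the non-increasing rearrangement of $|f|$), regarded as a function on $(0,\infty)$; and $f^{**}(t)=t^{-1}\int_0^t f^*(s)\,ds$, $t>0$. In the case $\mu(X)<\infty$ one normalizes $\mu(X)=1$. A Banach function space $(V,\|\cdot\|_V)$ on $\mathbb{R}_+$ is a complete normed space of measurable functions on $(0,\infty)$ such that in particular $|f_1|\le|f_2|$ implies $\|f_1\|_V\le\|f_2\|_V$. Boundedness of $H$ on $V$ means $\sup_{\|f\|_V=1}\|H[f]\|_V<\infty$. Rearrangement invariant means that the norm of $f$ depends only on the tail function $T_f$. Functions equal $\mu$-a.e. are identified. *)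

(* Defs.v *)
From HB Require Import structures.
From mathcomp Require Import all_boot all_order all_algebra.
From mathcomp Require Import all_classical all_reals all_analysis.

Set Implicit Arguments.
Unset Strict Implicit.
Unset Printing Implicit Defensive.

Import Order.TTheory GRing.Theory Num.Theory.
Import numFieldNormedType.Exports.

Local Open Scope classical_set_scope.
Local Open Scope ring_scope.
Local Open Scope ereal_scope.

(* A space of real functions on D (a measurable subset of T) is given by its
   norm N, with the convention N f = +oo for measurable f outside the space;
   values of f outside D and on null sets are irrelevant by [bfs_lattice]. *)
Definition fun_space (R : realType) (d : measure_display)
    (T : measurableType d) (D : set T) (N : (T -> R) -> \bar R) :
    set (T -> R) :=
  [set f | measurable_fun D f /\ N f < +oo].

(* Stability of the space under linear combinations is contained in
   [bfs_homogeneous] (with 0 * +oo = 0) and [bfs_triangle], and stability under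
   passing to measurable functions of smaller modulus in [bfs_lattice]. *)
Record banach_function_space (R : realType) (d : measure_display)
    (T : measurableType d) (mu : {measure set T -> \bar R}) (D : set T)
    (N : (T -> R) -> \bar R) : Prop := {
  bfs_ge0 : forall f : T -> R, measurable_fun D f -> 0 <= N f ;
  bfs_definite : forall f : T -> R, measurable_fun D f ->
    N f = 0 <-> {ae mu, forall x, D x -> f x = 0%R} ;
  bfs_homogeneous : forall (c : R) (f : T -> R), measurable_fun D f ->
    N (fun x => c * f x)%R = `|c|%:E * N f ;
  bfs_triangle : forall f g : T -> R,
    measurable_fun D f -> measurable_fun D g ->
    N (fun x => f x + g x)%R <= N f + N g ;
  bfs_lattice : forall f g : T -> R,
    measurable_fun D f -> measurable_fun D g ->
    {ae mu, forall x, D x -> (`|f x| <= `|g x|)%R} -> N f <= N g ;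
  bfs_complete : forall u : nat -> T -> R,
    (forall n, fun_space D N (u n)) ->
    (forall e : R, (0 < e)%R ->
      \forall m & n \near \oo, N (fun x => u m x - u n x)%R < e%:E) ->
    exists2 f, fun_space D N f &
      N (fun x => u n x - f x)%R @[n --> \oo] --> 0
}.

(* The norm of an extended-real valued function: it is +oo unless the function
   is a.e. finite, hence identified with a real-valued one. *)
Definition ext_norm (R : realType) (d : measure_display)
    (T : measurableType d) (mu : {measure set T -> \bar R}) (D : set T)
    (N : (T -> R) -> \bar R) (g : T -> \bar R) : \bar R :=
  if `[< {ae mu, forall x, D x -> g x \is a fin_num} >]
  then N (fun x => fine (g x)) else +oo.

Definition tail (R : realType) (d : measure_display) (T : measurableType d)
    (mu : {measure set T -> \bar R}) (f : T -> R) (t : R) : \bar R :=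
  mu [set x | (t <= `|f x|)%R].

Definition rearrangement_invariant (R : realType) (d : measure_display)
    (T : measurableType d) (mu : {measure set T -> \bar R})
    (N : (T -> R) -> \bar R) : Prop :=
  forall f g : T -> R, measurable_fun setT f -> measurable_fun setT g ->
    (forall t : R, (0 <= t)%R -> tail mu f t = tail mu g t) -> N f = N g.

(* f^* : the generalized inverse of the non-increasing function [tail mu f];
   the value is +oo when the set is empty. *)
Definition rearrangement (R : realType) (d : measure_display)
    (T : measurableType d) (mu : {measure set T -> \bar R}) (f : T -> R)
    (t : R) : \bar R :=
  ereal_inf [set s%:E | s in [set s : R | (0 <= s)%R /\ tail mu f s <= t%:E]].

Definition Rplus (R : realType) : set R := `]0%R, +oo[.

Definition hardy (R : realType) (f : R -> \bar R) (t : R) : \bar R :=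
  (t^-1)%:E * \int[lebesgue_measure]_(s in `]0%R, t[) f s.

(* f^** *)
Definition maximal_rearrangement (R : realType) (d : measure_display)
    (T : measurableType d) (mu : {measure set T -> \bar R}) (f : T -> R) :
    R -> \bar R :=
  hardy (rearrangement mu f).

Definition hardy_defined (R : realType) (N : (R -> R) -> \bar R) : Prop :=
  forall f : R -> R, fun_space (@Rplus R : set (measurableTypeR R)) N f ->
  forall t : R, (0 < t)%R ->
    (@lebesgue_measure R).-integrable `]0%R, t[ (fun s => (f s)%:E).

Definition hardy_bounded (R : realType) (N : (R -> R) -> \bar R) : Prop :=
  ereal_sup
    [set ext_norm lebesgue_measure (@Rplus R) N (hardy (fun s => (f s)%:E))
      | f in [set f : R -> R |
          fun_space (@Rplus R : set (measurableTypeR R)) N f /\ N f = 1]]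
  < +oo.

Definition Ynorm (R : realType) (d : measure_display)
    (X : measurableType d) (mu : {measure set X -> \bar R})
    (NV : (R -> R) -> \bar R) (f : X -> R) : \bar R :=
  ext_norm lebesgue_measure (@Rplus R) NV (maximal_rearrangement mu f).

(* Main.v *)
Require Import Defs.
From HB Require Import structures.
From mathcomp Require Import all_boot all_order all_algebra.
From mathcomp Require Import all_classical all_reals all_analysis.
From mathcomp Require Import measurable_realfun lra.

Set Implicit Arguments.
Unset Strict Implicit.
Unset Printing Implicit Defensive.

Import Order.TTheory GRing.Theory Num.Theory.
Import numFieldNormedType.Exports.

Local Open Scope classical_set_scope.
Local Open Scope ring_scope.
Local Open Scope ereal_scope.

(** The key identity is the K-functional formula
    [t f^**(t) = inf_l (t l + \int (|f| - l)_+ dmu)], the infimum being attained at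
    [l = f^*(t)]; it follows from the layer cake formula on [X] and on [(0, t)].
    Using it with [l = \sum_k g_k^*(t)] gives countable subadditivity: if
    [|f| <= \sum_k |g_k|] a.e. then [f^**(t) <= \sum_k g_k^**(t)]. This contains the
    triangle inequality and the lattice property.
    For completeness it is enough to sum series with [N (g_k) <= 2^-k]. In [V] the
    partial sums of the [g_k^**] converge to some [h] which dominates them a.e.
    Applied to multiples of the indicator of [{\sum_k |g_k| = +oo}], subadditivity
    shows that [\sum_k g_k] converges a.e. to some [f]; applied to the tails, it gives
    [(\sum_(k < m) g_k - f)^** <= h - \sum_(k < m) g_k^**], whose norm tends to 0.
    No Fatou property of [V] is needed. *)

(** * The layer cake formula and lengths of level sets *)

Lemma measurable_Rplus (R : realType) : measurable (@Rplus R).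
Proof. exact: measurable_itv. Qed.

(** Tonelli's theorem for the indicator of the subgraph [{(x, s) : 0 < s < h x}]: its section at [x]
    has length [h x], and its section at [s > 0] is the superlevel set. *)
Lemma layer_cake (R : realType) (d : measure_display) (T : measurableType d)
    (mu : {sigma_finite_measure set T -> \bar R}) (h : T -> \bar R) :
  measurable_fun setT h -> (forall x, 0 <= h x) ->
  \int[mu]_x h x =
  \int[lebesgue_measure]_(s in @Rplus R) mu [set x | s%:E < h x].
Proof.
move=> mh h0.
pose A : set (T * measurableTypeR R) :=
  (snd @^-1` (@Rplus R)) `&` [set z | z.2%:E < h z.1].
have mA : measurable A.
  apply: measurableI.
    rewrite -[X in measurable X]setTI.
    apply: (@measurable_snd _ _ T (measurableTypeR R) measurableT).
    exact: measurable_Rplus.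
  rewrite -[X in measurable X]setTI; apply: measurable_lte => //.
    by apply/measurable_EFinP; exact: measurable_snd.
  by apply: measurableT_comp => //; exact: measurable_fst.
transitivity (\int[mu]_x fubini_F (@lebesgue_measure R) (EFin \o \1_A) x).
  apply: eq_integral => x _; rewrite indic_fubini_tonelli_FE//=.
  have := h0 x; case hx : (h x) => [r| |]//= r0.
    rewrite [X in lebesgue_measure X](_ : _ = `]0%R, r[%classic); last first.
      apply/seteqP; split => s; rewrite /xsection/= inE /A /Rplus/= !in_itv/= hx.
        by rewrite andbT lte_fin => -[-> ->].
      by rewrite andbT lte_fin => /andP[].
    rewrite lebesgue_measure_itv/= lte_fin -EFinD subr0; case: ifPn => //.
    rewrite -leNgt => r_le0; move: r0; rewrite lee_fin => r_ge0.
    by congr EFin; apply/eqP; rewrite eq_le; apply/andP.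
  rewrite [X in lebesgue_measure X](_ : _ = `]0%R, +oo[%classic); last first.
    apply/seteqP; split => s; rewrite /xsection/= inE /A /Rplus/= !in_itv/= hx.
      by case.
    by move=> s0; split=> //; rewrite ltry.
  by rewrite lebesgue_measure_itv/= ltry.
rewrite (indic_fubini_tonelli _ _ mA) [RHS]integral_mkcond.
apply: eq_integral => s _; rewrite indic_fubini_tonelli_GE//= patchE.
case: ifPn => [/set_mem s0|/negP sR].
  congr (mu _); apply/seteqP.
  by split => x; rewrite /ysection/= inE /A/= => // -[].
rewrite (_ : ysection _ _ = set0) ?measure0//; apply/seteqP; split => x //.
by rewrite /ysection/= inE /A/= => -[/mem_set/sR].
Qed.

(** With [a = mu {|f| > s}] this is the length of the part of []0, t[] where [f^*] exceeds [s], by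
    [rearrangement_gtE] below. *)
Lemma lebesgue_measure_lt (R : realType) (t : R) (a : \bar R) : (0 < t)%R -> 0 <= a ->
  lebesgue_measure (`]0%R, t[ `&` [set u | u%:E < a]) = mine t%:E a.
Proof.
move=> t0; case: a => [a| |] // a0; last first.
  rewrite (_ : [set u | u%:E < +oo] = setT); last first.
    by apply/seteqP; split => // x _; exact: ltry.
  by rewrite setIT lebesgue_measure_itv/= lte_fin t0 -EFinD subr0 min_l// leey.
rewrite [X in lebesgue_measure X](_ : _ = `]0%R, (Num.min t a)[%classic); last first.
  apply/seteqP; split => x; rewrite /= !in_itv/= ?lte_fin ?lt_min.
    by move=> [/andP[-> ->] ->].
  by move=> /and3P[-> -> ->].
rewrite lebesgue_measure_itv/= lte_fin -EFinD subr0 EFin_min; case: ifPn => //.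
rewrite -leNgt ge_min leNgt t0/= => aN.
have -> : a = 0%R by apply/eqP; rewrite eq_le aN.
by rewrite min_r// lee_fin ltW.
Qed.

(** * The rearrangement [f^*] and the K-functional formula *)

Section rearrangement.
Context (R : realType) (d : measure_display) (X : measurableType d).
Variable mu : {sigma_finite_measure set X -> \bar R}.
Implicit Types (f g : X -> R) (s t u l : R).

Let measurable_gt f s : measurable_fun setT f ->
  measurable [set x | (s < `|f x|)%R].
Proof.
move=> mf; have mN : measurable_fun setT (fun x => `|f x|%R) by exact: measurableT_comp.
have := @measurable_fun_ltr _ _ _ _ _ _ (measurable_cst s) mN measurableT [set true].
by rewrite setTI; apply.
Qed.

Let measurable_ge f s : measurable_fun setT f ->
  measurable [set x | (s <= `|f x|)%R].
Proof.
move=> mf; have mN : measurable_fun setT (fun x => `|f x|%R) by exact: measurableT_comp.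
have := @measurable_fun_ler _ _ _ _ _ _ (measurable_cst s) mN measurableT [set true].
by rewrite setTI; apply.
Qed.

Lemma rearrangement_ge0 f t : 0 <= rearrangement mu f t.
Proof. by apply: le_ereal_inf_tmp => _ [s [s0 _] <-]; rewrite lee_fin. Qed.

Lemma rearrangement_noninc f s t : (s <= t)%R ->
  rearrangement mu f t <= rearrangement mu f s.
Proof.
move=> st; apply: ereal_inf_le_tmp => _ [r [r0 rs] <-].
by exists r => //; split=> //; apply: le_trans rs _; rewrite lee_fin.
Qed.

(** This duality replaces the infimum defining [f^*] in the layer cake arguments. It is exact for
    the strict sets [{|f| > s}], because these are increasing unions of sets [{|f| >= r}] with
    [r > s]. *)
Lemma rearrangement_gtE f s u : measurable_fun setT f -> (0 <= s)%R ->
  (s%:E < rearrangement mu f u) = (u%:E < mu [set x | (s < `|f x|)%R]).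
Proof.
move=> mf s0; rewrite !ltNge; congr (~~ _); apply/idP/idP => [fus|dsu].
  (* If [f^*(u) <= s], some admissible level lies below [s + 1/(n+1)]; the bound then passes to
     [{|f| > s}] by continuity from below. *)
  have tailu n : tail mu f (s + n.+1%:R^-1) <= u%:E.
    have : rearrangement mu f u < (s + n.+1%:R^-1)%:E.
      by apply: le_lt_trans fus _; rewrite lte_fin ltrDl invr_gt0.
    move=> /ereal_inf_lt[_ [r [r0 ru] <-]]; rewrite lte_fin => rs.
    apply: le_trans ru.
    apply: le_measure; rewrite ?inE; [exact: measurable_ge..|].
    by move=> x/=; apply: le_trans; exact: ltW.
  have U : [set x | (s < `|f x|)%R] =
      \bigcup_n [set x | (s + n.+1%:R^-1 <= `|f x|)%R].
    apply/seteqP; split => x/=.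
      move=> /ltr_add_invr[k sk]; exists k => //=; exact: ltW.
    by case=> n _ /=; apply: lt_le_trans; rewrite ltrDl invr_gt0.
  rewrite U.
  pose F n := [set x | (s + n.+1%:R^-1 <= `|f x|)%R].
  have /cvg_lim <- // : mu \o F @ \oo --> mu (\bigcup_n F n).
    apply: nondecreasing_cvg_mu => //.
    - by move=> n; exact: measurable_ge.
    - by rewrite -U; exact: measurable_gt.
    - move=> m n mn; apply/subsetPset => x/=; apply: le_trans.
      by rewrite lerD2l lef_pV2 ?posrE// ler_nat.
  apply: lime_le; last by apply: nearW => n; exact: tailu.
  apply: ereal_nondecreasing_is_cvgn => m n mn.
  apply: le_measure; rewrite ?inE; [exact: measurable_ge..|].
  move=> x/=; apply: le_trans.
  by rewrite lerD2l lef_pV2 ?posrE// ler_nat.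
(* Conversely, [mu {|f| > s} <= u] makes every level [s + e] with [e > 0] admissible in the
   infimum. *)
apply/lee_addgt0Pr => e e0; apply: ereal_inf_lbound; exists (s + e)%R => //.
split; first by rewrite addr_ge0// ltW.
apply: le_trans dsu; apply: le_measure; rewrite ?inE.
- exact: measurable_ge.
- exact: measurable_gt.
- by move=> x /=; apply: lt_le_trans; rewrite ltrDl.
Qed.

Lemma measurable_rearrangement f : measurable_fun setT f ->
  measurable_fun setT (rearrangement mu f).
Proof.
move=> mf _; apply: (measurability _ (ErealGenOInfty.measurableE R)) => //.
move=> _ [_ [x ->] <-]; rewrite setTI.
apply: is_interval_measurable => a b /=; rewrite !in_itv/= !andbT => _ xb.
move=> c /andP[_ cb].
by rewrite in_itv/= andbT (lt_le_trans xb)// rearrangement_noninc.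
Qed.

Let excess f l x : \bar R := (Num.max (`|f x| - l) 0)%:E.

Let measurable_excess f l : measurable_fun setT f ->
  measurable_fun setT (excess f l).
Proof.
move=> mf; apply/measurable_EFinP; apply: measurable_maxr => //.
by apply: measurable_funB => //; exact: measurableT_comp.
Qed.

Let excess_ge0 f l x : 0 <= excess f l x.
Proof. by rewrite lee_fin le_max lexx orbT. Qed.

Lemma integral_excess f l : measurable_fun setT f ->
  \int[mu]_x (Num.max (`|f x| - l) 0)%:E =
  \int[lebesgue_measure]_(s in @Rplus R) mu [set x | (l + s < `|f x|)%R].
Proof.
move=> mf; rewrite (layer_cake mu (measurable_excess l mf) (excess_ge0 f l)).
apply: eq_integral => s; rewrite inE /Rplus/= in_itv/= andbT => s0.
congr (mu _); apply/seteqP; split => x/=; rewrite /excess lte_fin lt_max.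
  by move=> /orP[|/(lt_trans s0)]; rewrite ?ltxx// ltrBrDl.
by rewrite ltrBrDl => ->.
Qed.

(** Layer cake on []0, t[]: by [rearrangement_gtE] and [lebesgue_measure_lt], the excess of [f^*] is
    above [s] on a set of length [min(t, mu {|f| > l + s})]. The truncation at [t] is the only
    difference from [integral_excess]. *)
Lemma integral_excess_rearrangement f l t : measurable_fun setT f ->
  (0 <= l)%R -> (0 < t)%R ->
  \int[lebesgue_measure]_(u in `]0%R, t[) maxe (rearrangement mu f u - l%:E) 0 =
  \int[lebesgue_measure]_(s in @Rplus R)
    mine t%:E (mu [set x | (l + s < `|f x|)%R]).
Proof.
move=> mf l0 t0; rewrite integral_mkcond.
set h := (X in X \_ _).
have mh : measurable_fun setT h.
  apply: measurable_maxe => //; apply: emeasurable_funB => //.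
  exact: measurable_rearrangement.
have h0 u : 0 <= h u by rewrite le_max lexx orbT.
rewrite layer_cake.
- apply: eq_integral => s; rewrite inE /Rplus/= in_itv/= andbT => s0.
  rewrite -lebesgue_measure_lt//; congr (lebesgue_measure _).
  apply/seteqP; split => u/=; rewrite patchE.
    case: ifPn => [/set_mem ut|_]; last by rewrite lte_fin ltNge ltW.
    rewrite /h lt_max [s%:E < 0]lte_fin (lt_gtF s0) orbF.
    rewrite lteBrDl// -EFinD => su; split => //.
    by rewrite -rearrangement_gtE// addr_ge0// ltW.
  move=> [ut]; rewrite mem_set// /h lt_max lteBrDl// -EFinD => us.
  by rewrite rearrangement_gtE ?us// addr_ge0// ltW.
- by apply/(measurable_restrictT _ _).1 => //; exact: measurable_funS mh.
- by move=> u; rewrite patchE; case: ifPn.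
Qed.

Let mexcess_rearrangement f l D : measurable_fun setT f -> 
   measurable_fun D (fun u => maxe (rearrangement mu f u - l%:E) 0).
Proof.
move=> mf; apply: (@measurable_funS _ _ _ _ setT) => //.
apply: measurable_maxe => //; apply: emeasurable_funB => //.
exact: measurable_rearrangement.
Qed.

Lemma integral_cst_excess f l t : measurable_fun setT f -> (0 <= l)%R ->
  (0 < t)%R ->
  \int[lebesgue_measure]_(u in `]0%R, t[)
     (l%:E + maxe (rearrangement mu f u - l%:E) 0) =
  (t * l)%:E + \int[lebesgue_measure]_(u in `]0%R, t[)
     maxe (rearrangement mu f u - l%:E) 0.
Proof.
move=> mf l0 t0; rewrite ge0_integralD//; last 2 first.
- by move=> u _; rewrite le_max lexx orbT.
- exact: mexcess_rearrangement.
congr (_ + _); rewrite (integral_cst _ _ l%:E)//=.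
rewrite lebesgue_measure_itv/= lte_fin.
by rewrite t0 -EFinD subr0 -EFinM mulrC.
Qed.

Let measurable_dist f l : measurable_fun setT f -> measurable_fun (@Rplus R)
  (fun s : R => mu [set x | (l + s < `|f x|)%R]).
Proof.
move=> mf; apply: (@measurable_funS _ _ _ _ setT) => //.
move=> _; apply: (measurability _ (ErealGenOInfty.measurableE R)) => //.
move=> _ [_ [x ->] <-]; rewrite setTI.
apply: is_interval_measurable => a b /=; rewrite !in_itv/= !andbT => _ xb.
move=> c /andP[_ cb].
rewrite in_itv/= andbT (lt_le_trans xb)//.
apply: le_measure; rewrite ?inE; [exact: measurable_gt..|].
by move=> y/=; apply: le_lt_trans; rewrite lerD2l.
Qed.

(* Together with the equality case below, this is the K-functional formula
   t f^**(t) = inf_l (t l + \int (|f| - l)_+). *)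
Lemma integral_rearrangement_le f l t : measurable_fun setT f -> (0 <= l)%R ->
  (0 < t)%R ->
  \int[lebesgue_measure]_(u in `]0%R, t[) rearrangement mu f u <=
  (t * l)%:E + \int[mu]_x (Num.max (`|f x| - l) 0)%:E.
Proof.
move=> mf l0 t0.
apply: (@le_trans _ _ (\int[lebesgue_measure]_(u in `]0%R, t[)
     (l%:E + maxe (rearrangement mu f u - l%:E) 0))).
  apply: ge0_le_integral => //.
  - by move=> u _; exact: rearrangement_ge0.
  - by apply: measurable_funS (measurable_rearrangement mf).
  - by apply: emeasurable_funD => //; exact: mexcess_rearrangement.
  - by move=> u _; rewrite -leeBlDl// le_max lexx.
rewrite integral_cst_excess// leeD2l//.
rewrite integral_excess_rearrangement// integral_excess//.
apply: ge0_le_integral => //; first exact: measurable_Rplus.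
- by move=> s _; rewrite le_min measure_ge0 lee_fin ltW.
- by apply: measurable_mine => //; exact: measurable_dist.
- exact: measurable_dist.
- by move=> s _; rewrite ge_min lexx orbT.
Qed.

Lemma integral_rearrangement_eq f l t : measurable_fun setT f ->
  (0 < t)%R -> rearrangement mu f t = l%:E ->
  \int[lebesgue_measure]_(u in `]0%R, t[) rearrangement mu f u =
  (t * l)%:E + \int[mu]_x (Num.max (`|f x| - l) 0)%:E.
Proof.
move=> mf t0 ftl.
have l0 : (0 <= l)%R by rewrite -lee_fin -ftl rearrangement_ge0.
transitivity (\int[lebesgue_measure]_(u in `]0%R, t[)
     (l%:E + maxe (rearrangement mu f u - l%:E) 0)).
  apply: eq_integral => u; rewrite inE/= in_itv/= => /andP[_ ut].
  have lf : 0 <= rearrangement mu f u - l%:E.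
    by rewrite leeBrDl// adde0 -ftl rearrangement_noninc// ltW.
  by rewrite (max_l lf) addeC subeK.
rewrite integral_cst_excess//; congr (_ + _).
rewrite integral_excess_rearrangement// integral_excess//.
apply: eq_integral => s; rewrite inE /Rplus/= in_itv/= andbT => s0.
rewrite min_r// leNgt -rearrangement_gtE//; last by rewrite addr_ge0// ltW.
by rewrite ftl lte_fin -leNgt lerDl ltW.
Qed.

(** Since [f^* >= f^*(s)] on []0, s[], a finite integral forces [f^*(s)] to be finite, and a zero
    integral forces it to vanish. *)
Lemma integral_rearrangement_ge f s t : measurable_fun setT f ->
  (0 < s)%R -> (s <= t)%R ->
  s%:E * rearrangement mu f s <=
  \int[lebesgue_measure]_(u in `]0%R, t[) rearrangement mu f u.
Proof.
move=> mf s0 st.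
have -> : s%:E * rearrangement mu f s =
    \int[lebesgue_measure]_(u in `]0%R, s[) rearrangement mu f s.
  rewrite (integral_cst _ _ (rearrangement mu f s))//= lebesgue_measure_itv/=.
  by rewrite lte_fin s0 -EFinD subr0 muleC.
apply: (@le_trans _ _ (\int[lebesgue_measure]_(u in `]0%R, s[) rearrangement mu f u)).
  apply: ge0_le_integral => //.
  - by move=> u _; exact: rearrangement_ge0.
  - by apply: measurable_funS (measurable_rearrangement mf).
  - by move=> u /=; rewrite in_itv/= => /andP[_ /ltW]; exact: rearrangement_noninc.
apply: ge0_subset_integral => //.
- by apply: measurable_funS (measurable_rearrangement mf).
- by move=> u _; exact: rearrangement_ge0.
- by apply: subset_itvl; rewrite bnd_simp.
Qed.

(** The equality case is used for each [g_k] at the level [l_k = g_k^*(t)], the inequality for [f]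
    at [L = \sum_k l_k]. The excesses compare because [(\sum_k a_k - \sum_k l_k)_+ <= \sum_k (a_k -
    l_k)_+]. *)
Lemma integral_rearrangement_series f (g : nat -> X -> R) t :
  measurable_fun setT f -> (forall k, measurable_fun setT (g k)) -> (0 < t)%R ->
  {ae mu, forall x, `|f x|%:E <= \sum_(k <oo) `|g k x|%:E} ->
  \int[lebesgue_measure]_(u in `]0%R, t[) rearrangement mu f u <=
  \sum_(k <oo) \int[lebesgue_measure]_(u in `]0%R, t[) rearrangement mu (g k) u.
Proof.
move=> mf mg t0 fg.
set I := fun k => \int[lebesgue_measure]_(u in `]0%R, t[) rearrangement mu (g k) u.
have I0 k : 0 <= I k by apply: integral_ge0 => u _; exact: rearrangement_ge0.
have [->|sumfin] := eqVneq (\sum_(k <oo) I k) +oo; first by rewrite leey.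
have tge k : t%:E * rearrangement mu (g k) t <= I k.
  exact: integral_rearrangement_ge.
have Ifin k : I k < +oo.
  rewrite ltey; apply: contra_neq sumfin => Ik.
  exact: (@nneseries_pinfty _ I xpredT k).
(* The equality case needs a real level: [t g_k^*(t) <= I k < +oo] provides it. *)
have fk k : rearrangement mu (g k) t \is a fin_num.
  rewrite ge0_fin_numE ?rearrangement_ge0// ltey.
  apply/eqP => gt; move: (le_lt_trans (tge k) (Ifin k)).
  by rewrite gt gt0_muley ?ltxx ?lte_fin.
pose l k := fine (rearrangement mu (g k) t).
have lE k : rearrangement mu (g k) t = (l k)%:E by rewrite /l fineK.
have l0 k : (0 <= l k)%R by rewrite -lee_fin -lE rearrangement_ge0.
(* Summing [tge] bounds [t L] by the finite right-hand side, so [L] is a real level too. *)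
have Ladd : t%:E * \sum_(k <oo) (l k)%:E <= \sum_(k <oo) I k.
  rewrite -nneseriesZl; last by move=> k _; rewrite lee_fin.
  apply: lee_nneseries => [k _ _|k _]; last by rewrite -lE.
  by rewrite mule_ge0 ?lee_fin// ltW.
have L0 : 0 <= \sum_(k <oo) (l k)%:E.
  by apply: nneseries_ge0 => k _ _; rewrite lee_fin.
have Lfin : \sum_(k <oo) (l k)%:E \is a fin_num.
  rewrite ge0_fin_numE// ltey; apply: contra_neq sumfin => L.
  by apply/eqP; move: Ladd; rewrite L gt0_muley ?lte_fin// leye_eq.
pose L := fine (\sum_(k <oo) (l k)%:E).
have LE : \sum_(k <oo) (l k)%:E = L%:E by rewrite /L fineK.
have Lge0 : (0 <= L)%R by rewrite -lee_fin -LE.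
apply: le_trans (integral_rearrangement_le mf Lge0 t0) _.
have -> : \sum_(k <oo) I k = (t * L)%:E + \sum_(k <oo) \int[mu]_x excess (g k) (l k) x.
  rewrite EFinM -LE -nneseriesZl; last by move=> k _; rewrite lee_fin.
  rewrite -nneseriesD; last 2 first.
  - by move=> k _ _; rewrite mule_ge0 ?lee_fin// ltW.
  - by move=> k _ _; apply: integral_ge0 => x _; exact: excess_ge0.
  apply: eq_eseriesr => k _; rewrite /I (integral_rearrangement_eq (mg k) t0 (lE k)).
  by rewrite EFinM.
rewrite leeD2l// -integral_nneseries//; last by move=> k; exact: measurable_excess.
apply: ae_ge0_le_integral => //.
- by move=> x _; exact: excess_ge0.
- exact: measurable_excess.
- by move=> x _; apply: nneseries_ge0.
- by apply: ge0_emeasurable_sum => // k _; exact: measurable_excess.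
apply: filterS fg => x fgx _.
have E0 : 0 <= \sum_(k <oo) excess (g k) (l k) x by exact: nneseries_ge0.
rewrite EFin_max ge_max E0 andbT EFinB leeBlDl//; apply: le_trans fgx _.
rewrite -LE -nneseriesD//; last by move=> k _ _; rewrite lee_fin.
apply: lee_nneseries => // k _; rewrite /excess -EFinD lee_fin.
by rewrite -lerBlDl le_max lexx.
Qed.

(** A single [t] suffices: if [f^*] vanishes on []0, t]], duality at level 0 gives
    [mu {|f| > 0} <= s] for all small [s > 0]. *)
Lemma integral_rearrangement_eq0 f t : measurable_fun setT f -> (0 < t)%R ->
  \int[lebesgue_measure]_(u in `]0%R, t[) rearrangement mu f u = 0 <->
  {ae mu, forall x, f x = 0%R}.
Proof.
move=> mf t0; have E : [set x | (0 < `|f x|)%R] = ~` [set x | f x = 0%R].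
  by apply/seteqP; split => x/=; rewrite normr_gt0 => /eqP.
have ae0 : {ae mu, forall x, f x = 0%R} <-> mu [set x | (0 < `|f x|)%R] = 0.
  by rewrite -negligibleP ?E; last by rewrite -E; exact: measurable_gt.
rewrite ae0; split => [I0|d0].
  have f0 s : (0 < s)%R -> (s <= t)%R -> mu [set x | (0 < `|f x|)%R] <= s%:E.
    move=> s0 st; rewrite leNgt -rearrangement_gtE// -leNgt.
    have := integral_rearrangement_ge mf s0 st; rewrite I0.
    by rewrite pmule_rle0 ?lte_fin.
  apply/eqP; rewrite eq_le measure_ge0 andbT; apply/lee_addgt0Pr => e e0.
  rewrite add0e; apply: le_trans (f0 (Num.min e t) _ _) _.
  - by rewrite lt_min e0.
  - by rewrite ge_min lexx orbT.
  - by rewrite lee_fin ge_min lexx.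
apply: integral0_eq => u; rewrite /= in_itv/= => /andP[u0 _].
apply/eqP; rewrite eq_le rearrangement_ge0 andbT leNgt rearrangement_gtE//.
by rewrite d0 lte_fin -leNgt ltW.
Qed.

(** Both sides are nonnegative and, by duality, lie above the same reals [s >= 0]. For [c = 0] the
    identity fails at negative [u], where the rearrangement is [+oo]. *)
Lemma rearrangementZ f (c : R) u : measurable_fun setT f -> c != 0%R ->
  rearrangement mu (fun x => c * f x)%R u = `|c|%:E * rearrangement mu f u.
Proof.
move=> mf c0; have cgt : (0 < `|c|)%R by rewrite normr_gt0.
have mcf : measurable_fun setT (fun x => c * f x)%R by exact: measurable_funM.
have key s : (0 <= s)%R -> (s%:E < rearrangement mu (fun x => c * f x)%R u) =
    (s%:E < `|c|%:E * rearrangement mu f u).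
  move=> s0; rewrite rearrangement_gtE// -lte_pdivrMl//.
  rewrite -EFinM rearrangement_gtE; [|by []|by rewrite mulr_ge0// invr_ge0 ltW].
  congr (_ < mu _); apply/seteqP; split => x/=; rewrite normrM.
    by rewrite ltr_pdivrMl.
  by rewrite ltr_pdivrMl.
have r0 := rearrangement_ge0 (fun x => c * f x)%R u.
have c0' : 0 <= `|c|%:E * rearrangement mu f u.
  by rewrite mule_ge0// rearrangement_ge0.
move: r0 c0' key.
move: (rearrangement mu _ u) (_ * _) => a b a0 b0 key.
have H (x y : \bar R) : 0 <= x -> 0 <= y ->
    (forall s, (0 <= s)%R -> s%:E < y -> s%:E < x) -> y <= x.
  move=> x0 y0 xy; rewrite leNgt; apply/negP.
  case: x x0 xy => [x| |]// x0 xy; last by rewrite ltNge leey.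
  by move=> /(xy x x0); rewrite ltxx.
by apply/eqP; rewrite eq_le; apply/andP; split; apply: H => // s s0; rewrite key.
Qed.

End rearrangement.

(** * The maximal rearrangement [f^**]: measurability, subadditivity, homogeneity *)

Section maximal_rearrangement.
Context (R : realType) (d : measure_display) (X : measurableType d).
Variable mu : {sigma_finite_measure set X -> \bar R}.
Implicit Types (f g h : X -> R) (t : R).

Lemma maximal_rearrangement_ge0 f t : (0 < t)%R ->
  0 <= maximal_rearrangement mu f t.
Proof.
move=> t0; rewrite mule_ge0 ?lee_fin ?invr_ge0 ?(ltW t0)//.
by apply: integral_ge0 => u _; exact: rearrangement_ge0.
Qed.

Lemma measurable_maximal_rearrangement f : measurable_fun setT f ->
  measurable_fun (@Rplus R) (maximal_rearrangement mu f).
Proof.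
move=> mf.
apply: (@emeasurable_funM _ _ _ _ (fun t : R => (t^-1)%:E)
  (fun t => \int[lebesgue_measure]_(s in `]0%R, t[) rearrangement mu f s)).
  apply/measurable_EFinP; apply: open_continuous_measurable_fun => //.
  move=> t; rewrite inE /Rplus/= in_itv/= andbT => t0.
  by apply: inv_continuous; rewrite gt_eqF.
(* The integral is nondecreasing in [t], so its superlevel sets are intervals. *)
apply: (@measurable_funS _ _ _ _ setT) => //.
move=> _; apply: (measurability _ (ErealGenOInfty.measurableE R)) => //.
move=> _ [_ [x ->] <-]; rewrite setTI.
apply: is_interval_measurable => a b /=; rewrite !in_itv/= !andbT => xa _.
move=> c /andP[ac _]; rewrite in_itv/= andbT; apply: (lt_le_trans xa).
apply: ge0_subset_integral => //.
- by apply: measurable_funS (measurable_rearrangement mu mf).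
- by move=> u _; exact: rearrangement_ge0.
- by apply: subset_itvl; rewrite bnd_simp.
Qed.

Lemma maximal_rearrangement_series f (g : nat -> X -> R) t :
  measurable_fun setT f -> (forall k, measurable_fun setT (g k)) -> (0 < t)%R ->
  {ae mu, forall x, `|f x|%:E <= \sum_(k <oo) `|g k x|%:E} ->
  maximal_rearrangement mu f t <=
  \sum_(k <oo) maximal_rearrangement mu (g k) t.
Proof.
move=> mf mg t0 fg; rewrite nneseriesZl; last first.
  by move=> k _; apply: integral_ge0 => u _; exact: rearrangement_ge0.
rewrite lee_pmul2l ?lte_fin ?invr_gt0//.
exact: integral_rearrangement_series.
Qed.

Lemma maximal_rearrangement_eq0 f t : measurable_fun setT f -> (0 < t)%R ->
  maximal_rearrangement mu f t = 0 <-> {ae mu, forall x, f x = 0%R}.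
Proof.
move=> mf t0; rewrite -(integral_rearrangement_eq0 mu mf t0).
rewrite /maximal_rearrangement /hardy; split => [/eqP|->]; last by rewrite mule0.
by rewrite mule_eq0 eqe invr_eq0 gt_eqF//= => /eqP.
Qed.

Lemma maximal_rearrangementZ f (c : R) t : measurable_fun setT f ->
  c != 0%R ->
  maximal_rearrangement mu (fun x => c * f x)%R t =
  `|c|%:E * maximal_rearrangement mu f t.
Proof.
move=> mf c0; rewrite /maximal_rearrangement /hardy muleCA; congr (_ * _).
under eq_integral do rewrite rearrangementZ//.
rewrite ge0_integralZl// ?lee_fin//.
- by apply: measurable_funS (measurable_rearrangement mu mf).
- by move=> u _; exact: rearrangement_ge0.
Qed.

(** Series subadditivity for [g, h, 0, 0, ...]. With [f = g + h] it yields the triangle inequality,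
    with [h = 0] monotonicity. *)
Lemma maximal_rearrangement_le_add f g h t : measurable_fun setT f ->
  measurable_fun setT g -> measurable_fun setT h -> (0 < t)%R ->
  {ae mu, forall x, (`|f x| <= `|g x| + `|h x|)%R} ->
  maximal_rearrangement mu f t <=
  maximal_rearrangement mu g t + maximal_rearrangement mu h t.
Proof.
move=> mf mg mh t0 fgh.
pose k n : X -> R := if n is n'.+1 then if n' is 0%N then h else cst 0%R else g.
have mk n : measurable_fun setT (k n) by case: n => [|[|n]] //=.
have twoterms (a : nat -> \bar R) : (forall n, 0 <= a n) ->
    (forall n, a n.+2 = 0) -> \sum_(n <oo) a n = a 0%N + a 1%N.
  move=> a0 a2; rewrite (@nneseries_split _ _ 0 2)// [X in _ + X]eseries0 ?adde0.
    by rewrite add0n big_nat_recl// big_nat1.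
  by case=> [|[|n]].
have := @maximal_rearrangement_series f k t mf mk t0; rewrite twoterms.
- apply; apply: filterS fgh => x fgx; rewrite twoterms ?lee_fin//.
  by move=> n; rewrite /k/= normr0.
- by move=> n; exact: maximal_rearrangement_ge0.
- by move=> n; apply/maximal_rearrangement_eq0 => //; exact: aeW.
Qed.

Lemma maximal_rearrangement_le f g t : measurable_fun setT f ->
  measurable_fun setT g -> (0 < t)%R ->
  {ae mu, forall x, (`|f x| <= `|g x|)%R} ->
  maximal_rearrangement mu f t <= maximal_rearrangement mu g t.
Proof.
move=> mf mg t0 fg.
have z0 : maximal_rearrangement mu (cst 0%R) t = 0.
  by apply/maximal_rearrangement_eq0 => //; exact: aeW.
rewrite -[leRHS]adde0 -z0; apply: maximal_rearrangement_le_add => //.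
by apply: filterS fg => x; rewrite normr0 addr0.
Qed.

Lemma eq_maximal_rearrangement f g :
  (forall t, (0 <= t)%R -> tail mu f t = tail mu g t) ->
  maximal_rearrangement mu f = maximal_rearrangement mu g.
Proof.
move=> fg; rewrite /maximal_rearrangement; congr hardy; apply/funext => t.
rewrite /rearrangement; congr ereal_inf; congr image.
by apply/seteqP; split => s [s0 st]; split => //; [rewrite -fg|rewrite fg].
Qed.

End maximal_rearrangement.

(** * Geometric series and completeness of normed function spaces *)

Lemma cvge0P (R : realType) (a : nat -> \bar R) : (forall n, 0 <= a n) ->
  a @ \oo --> 0 <->
  (forall e : R, (0 < e)%R -> \forall n \near \oo, a n < e%:E).
Proof.
move=> a0; split=> [/fine_cvgP[afin /cvgrPdist_lt acvg] e e0|ae].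
  have := acvg e e0; apply: filterS2 afin => n nfin /=.
  by rewrite sub0r normrN ger0_norm ?fine_ge0// -lte_fin fineK.
(* Finitely many terms may be [+oo]; the bound for [e = 1] makes all later ones finite. *)
have afin : \forall n \near \oo, a n \is a fin_num.
  by apply: filterS (ae 1%R ltr01) => n an; rewrite ge0_fin_numE// (lt_trans an) ?ltry.
apply/fine_cvgP; split => //; apply/cvgrPdist_lt => e e0.
apply: filterS2 afin (ae e e0) => n nfin /=.
by rewrite sub0r normrN ger0_norm ?fine_ge0// -lte_fin fineK.
Qed.

Lemma near_exp2V_lt (R : realType) (e : R) : (0 < e)%R ->
  \forall n \near \oo, (2 ^- n < e)%R.
Proof.
move=> e0; apply: filterS (near_infty_natSinv_expn_lt (PosNum e0)) => n /=.
by rewrite mul1r.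
Qed.

Section norms.
Context (R : realType) (d : measure_display) (T : measurableType d).
Variables (mu : {measure set T -> \bar R}) (D : set T) (N : (T -> R) -> \bar R).

Let measurable_fun_partial_sum (g : nat -> T -> R) m :
  (forall k, measurable_fun D (g k)) ->
  measurable_fun D (fun x => \sum_(k < m) g k x)%R.
Proof. by move=> mg; apply: measurable_sum. Qed.

Section series.
Hypothesis NV : banach_function_space mu D N.

Lemma bfs0 : N (cst 0%R) = 0.
Proof. by apply/(bfs_definite NV) => //; exact: aeW. Qed.

Lemma bfsN (f : T -> R) : measurable_fun D f -> N (fun x => - f x)%R = N f.
Proof.
move=> mf; rewrite -[RHS]mul1e.
have -> : 1 = `|(-1)%R : R|%:E by rewrite normrN1.
rewrite -(bfs_homogeneous NV)//; congr N; apply/funext => x.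
by rewrite mulN1r.
Qed.

(** The right-hand side is the sum of [2^-k] over [n <= k < n + p], in the closed form that makes
    the induction on [p] one triangle inequality per step. *)
Lemma bfs_geometric_sum_le (g : nat -> T -> R) n p :
  (forall k, measurable_fun D (g k)) -> (forall k, N (g k) <= (2 ^- k)%:E) ->
  N (fun x => \sum_(k < n + p) g k x - \sum_(k < n) g k x)%R <=
  (2 * 2 ^- n - 2 * 2 ^- (n + p))%:E.
Proof.
move=> mg Ng; elim: p => [|p IH].
  rewrite addn0 subrr (_ : (fun _ => _) = cst 0%R) ?bfs0//.
  by apply/funext => x; rewrite subrr.
rewrite addnS (_ : (fun _ => _) = (fun x =>
    (\sum_(k < n + p) g k x - \sum_(k < n) g k x) + g (n + p)%N x)%R); last first.
  by apply/funext => x; rewrite big_ord_recr/= addrAC.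
apply: (le_trans (bfs_triangle NV _ (mg (n + p)%N))).
  by apply: measurable_funB; exact: measurable_fun_partial_sum.
apply: (le_trans (leeD IH (Ng _))); rewrite -EFinD lee_fin.
rewrite [in leRHS]exprS invfM.
set a := (2 ^- n)%R; set b := (2 ^- (n + p))%R.
by rewrite mulrA divff// mul1r; lra.
Qed.

(** Applied in [V] to the functions [g_k^**]. Besides the norm limit [h], a pointwise a.e. bound by
    [h] is obtained; it comes from monotonicity of the partial sums and the lattice property. *)
Lemma bfs_geometric_series (g : nat -> T -> R) :
  (forall k, measurable_fun D (g k)) -> (forall k x, D x -> 0 <= g k x)%R ->
  (forall k, N (g k) <= (2 ^- k)%:E) ->
  exists h, [/\ fun_space D N h,
    {ae mu, forall x, D x -> forall m, (\sum_(k < m) g k x <= h x)%R} &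
    N (fun x => \sum_(k < m) g k x - h x)%R @[m --> \oo] --> 0].
Proof.
move=> mg g0 Ng.
pose S m x : R := (\sum_(k < m) g k x)%R.
have mS m : measurable_fun D (S m) by exact: measurable_fun_partial_sum.
have Sdist n p : N (fun x => S (n + p)%N x - S n x)%R <= (2 * 2 ^- n)%:E.
  apply: (le_trans (bfs_geometric_sum_le _ _ mg Ng)); rewrite lee_fin gerBl.
  by rewrite mulr_ge0// invr_ge0 exprn_ge0.
have [|e e0|h [mh Nh] Sh] := bfs_complete NV (u := S).
- move=> m; split => //; have := Sdist 0%N m; rewrite add0n.
  rewrite (_ : (fun _ => _) = S m); last first.
    by apply/funext => x; rewrite /S big_ord0 subr0.
  by move/le_lt_trans; apply; rewrite ltry.
- have e20 : (0 < e / 2)%R by rewrite divr_gt0.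
  have [n0 _ n0e] := near_exp2V_lt e20.
  have le_case m n : (n0 <= n)%N -> (n <= m)%N -> N (fun x => S m x - S n x)%R < e%:E.
    move=> n0n nm; rewrite -(subnKC nm); apply: (le_lt_trans (Sdist _ _)).
    by have := n0e n n0n; rewrite /= lte_fin; lra.
  exists ([set n | (n0 <= n)%N], [set n | (n0 <= n)%N]).
    by split; exists n0.
  move=> [m n] /= [n0m n0n]; have [mn|/ltnW nm] := leqP m n; last exact: le_case.
  rewrite (_ : (fun _ => _) = (fun x => - (S n x - S m x))%R).
    by rewrite bfsN ?le_case//; exact: measurable_funB.
  by apply/funext => x; rewrite opprB.
exists h; split => //.
suff : forall m, {ae mu, forall x, D x -> (S m x <= h x)%R}.
  by move=> /ae_foralln; apply: filterS => x Sx Dx m; exact: Sx.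
move=> m.
(* For [n >= m] one has [0 <= (S m - h)_+ <= |S n - h|] on [D], and the norm of the right side tends
   to 0; so the positive part has norm 0. *)
pose P x : R := Num.max (S m x - h x)%R 0%R.
have mP : measurable_fun D P.
  by apply: measurable_maxr => //; exact: measurable_funB.
have P0 : N P = 0.
  apply/eqP; rewrite eq_le (bfs_ge0 NV mP) andbT.
  apply: (cvge_to_ge Sh); exists m => // n /= mn.
  apply: (bfs_lattice NV) => //; first exact: measurable_funB.
  apply: aeW => x Dx; rewrite ger0_norm ?le_max ?lexx ?orbT//.
  rewrite ge_max normr_ge0 andbT; apply: le_trans (ler_norm _).
  rewrite lerD2r /S -(subnKC mn) big_split_ord/= lerDl sumr_ge0//.
  by move=> i _; exact: g0.
move/(bfs_definite NV mP) : P0; apply: filterS => x + Dx => /(_ Dx) Px.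
by rewrite -subr_le0 -Px le_max lexx.
Qed.

End series.

(** A Cauchy sequence has a subsequence whose increments have norm at most [2^-k], and it converges
    once the subsequence does. The norm axioms are listed separately because completeness of [N] is
    still to be proved. *)
Lemma complete_of_geometric_series :
  (forall f : T -> R, measurable_fun D f -> 0 <= N f) ->
  (forall f : T -> R, measurable_fun D f -> N (fun x => - f x)%R = N f) ->
  (forall f g : T -> R, measurable_fun D f -> measurable_fun D g ->
    N (fun x => f x + g x)%R <= N f + N g) ->
  (forall g : nat -> T -> R, (forall k, measurable_fun D (g k)) ->
    (forall k, N (g k) <= (2 ^- k)%:E) ->
    exists2 f : T -> R, measurable_fun D f &
      N (fun x => \sum_(k < m) g k x - f x)%R @[m --> \oo] --> 0) ->
  forall u : nat -> T -> R,
    (forall n, fun_space D N (u n)) ->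
    (forall e : R, (0 < e)%R ->
      \forall m & n \near \oo, N (fun x => u m x - u n x)%R < e%:E) ->
    exists2 f, fun_space D N f &
      N (fun x => u n x - f x)%R @[n --> \oo] --> 0.
Proof.
move=> N0 NN ND Nser u uN ucauchy.
have mu_ n : measurable_fun D (u n) by case: (uN n).
have mB n (f : T -> R) : measurable_fun D f -> measurable_fun D (fun x => u n x - f x)%R.
  by move=> mf; exact: measurable_funB.
have /choice[M uM] : forall k : nat, exists M : nat, forall m n,
    (M <= m)%N -> (M <= n)%N -> N (fun x => u m x - u n x)%R < (2 ^- k)%:E.
  move=> k; have k0 : (0 < 2 ^- k :> R)%R by rewrite invr_gt0 exprn_gt0.
  have [[A B] [[a _ Aa] [b _ Bb]] AB] := ucauchy _ k0.
  exists (maxn a b) => m n; rewrite !geq_max => /andP[am _] /andP[_ bn].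
  by apply: (AB (m, n)); split; [exact: Aa|exact: Bb].
pose K k := (\max_(i < k.+1) M i)%N.
have MK k : (M k <= K k)%N by exact: (leq_bigmax (Ordinal (ltnSn k))).
have KS k : (K k <= K k.+1)%N by rewrite {2}/K big_ord_recr/= leq_maxl.
pose g k x : R := (u (K k.+1) x - u (K k) x)%R.
have gsum m x : (\sum_(k < m) g k x = u (K m) x - u (K 0%N) x)%R.
  by rewrite -(big_mkord xpredT (fun k => g k x)) telescope_sumr.
have mg k : measurable_fun D (g k) by exact: mB.
have [|f0 mf0 f0cvg] := Nser g mg.
  move=> k; apply/ltW/uM; [exact: leq_trans (MK k) (KS k)|exact: MK].
(* The increments telescope to [u (K m) - u (K 0)], so the first term is added back. *)
pose f x : R := (u (K 0%N) x + f0 x)%R.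
have mf : measurable_fun D f by exact: measurable_funD.
have fcvg : N (fun x => u (K m) x - f x)%R @[m --> \oo] --> 0.
  apply: cvg_trans f0cvg; apply: near_eq_cvg; apply: nearW => m.
  congr N; apply/funext => x; rewrite gsum /f.
  by rewrite opprD addrA.
have ufcvg : N (fun x => u n x - f x)%R @[n --> \oo] --> 0.
  apply/cvge0P; first by move=> n; exact/N0/mB.
  move=> e e0; have e20 : (0 < e / 2)%R by rewrite divr_gt0.
  have [m1 _ m1e] := (cvge0P (fun m => N0 _ (mB (K m) f mf))).1 fcvg _ e20.
  have [m2 _ m2e] := near_exp2V_lt e20.
  (* From [m1] on the subsequence is [e/2]-close to [f]; from [m2] on the Cauchy bound [2^-m] is
     below [e/2]. *)
  pose m := maxn m1 m2; exists (K m) => // n /= Kn.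
  rewrite (_ : (fun _ => _) =
      (fun x => (u n x - u (K m) x) + (u (K m) x - f x))%R); last first.
    by apply/funext => x; rewrite addrA subrK.
  apply: le_lt_trans (ND _ _ _ _) _; [exact: mB|exact: mB|].
  rewrite (splitr e) EFinD lteD//; last by apply: m1e; rewrite /= leq_maxl.
  apply: (lt_trans (uM m _ _ _ _)); [exact: leq_trans Kn|exact: MK|].
  by rewrite lte_fin m2e//= leq_maxr.
exists f => //; split => //.
have [m _ /(_ m (leqnn _))/= um1] :=
  (cvge0P (fun m => N0 _ (mB m f mf))).1 ufcvg _ ltr01.
rewrite (_ : f = (fun x => - (u m x - f x) + u m x)%R); last first.
  by apply/funext => x; rewrite opprB subrK.
apply: le_lt_trans (ND _ _ _ _) _ => //.
  by apply: measurableT_comp => //; exact: mB.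
rewrite NN; last exact: mB.
by rewrite lte_add_pinfty//; [exact: lt_trans um1 (ltry _)|case: (uN m)].
Qed.

End norms.

(** * Almost everywhere statements on the half-line and tails of series *)

(* Typeclass resolution does not find this instance when functions are written on
   [R] instead of [measurableTypeR R]. *)
Lemma lebesgue_ae_filter (R : realType) :
  @Filter R (almost_everywhere (@lebesgue_measure R)).
Proof. exact: (@ae_filter_ringOfSetsType _ (measurableTypeR R)). Qed.
#[local] Hint Extern 0 (Filter (nbhs (almost_everywhere _))) =>
  (exact: lebesgue_ae_filter) : typeclass_instances.

(** The half-line has infinite measure, so no null set contains it. This extracts from an a.e.
    statement in [V] one [t] at which to argue about [mu]. *)
Lemma ae_Rplus_exists (R : realType) (P : R -> Prop) :
  {ae lebesgue_measure, forall t, @Rplus R t -> P t} ->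
  exists2 t, (0 < t)%R & P t.
Proof.
move=> [A [mA A0 PA]]; apply: contrapT => nP.
have : lebesgue_measure (@Rplus R) <= lebesgue_measure A.
  apply: le_measure; rewrite ?inE//; first exact: measurable_Rplus.
  move=> t t0; apply: PA => /= /(_ t0) Pt; apply: nP; exists t => //.
  by move: t0; rewrite /Rplus/= in_itv/= andbT.
by rewrite A0 lebesgue_measure_itv/= ltry leye_eq.
Qed.

(** Absolute convergence makes [limn] a true limit; the estimate is the limit in [n] of the triangle
    inequality for the terms from [m] to [n]. *)
Lemma series_tail_le (R : realType) (a : nat -> R) m :
  \sum_(k <oo) `|a k|%:E < +oo ->
  `|\sum_(k < m) a k - limn (series a)|%:E <= \sum_(k <oo) `|a (k + m)%N|%:E.
Proof.
move=> afin.
have acvg : cvgn (series a) by apply: normed_cvg; apply: (@nnseries_is_cvg _ (fun k => `|a k|%R)).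
have a0 k : 0 <= `|a k|%:E by rewrite lee_fin.
rewrite (@nneseries_addn _ (fun k => `|a k|%:E))//.
set C := (X in _ <= X).
have Cfin : C \is a fin_num.
  rewrite ge0_fin_numE; last by apply: nneseries_ge0.
  apply: le_lt_trans afin; rewrite [leRHS](@nneseries_split _ _ 0 m)// add0n.
  by rewrite leeDr// sume_ge0.
rewrite -(fineK Cfin) lee_fin.
have dcvg : `|\sum_(k < m) a k - series a n|%R @[n --> \oo] -->
    `|\sum_(k < m) a k - limn (series a)|%R.
  by apply: cvg_norm; apply: cvgB => //; exact: cvg_cst.
apply: (cvgr_to_le dcvg); exists m => // n /= mn.
rewrite distrC -(big_mkord xpredT) -[X in (_ - X)%R]/(series a m).
rewrite sub_series_geq//; apply: le_trans (ler_norm_sum _ _ _) _.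
rewrite -lee_fin fineK// -sumEFin; exact: nneseries_lim_ge.
Qed.

(** * The norm of [Y]: axioms and completeness *)

Section Y.
Context (R : realType) (d : measure_display) (X : measurableType d).
Variables (mu : {sigma_finite_measure set X -> \bar R}) (NV : (R -> R) -> \bar R).
Hypothesis V_bfs : banach_function_space (@lebesgue_measure R) (@Rplus R) NV.
Implicit Types f g : X -> R.

Let fine_maximal f t : R := fine (maximal_rearrangement mu f t).

Let measurable_fine_maximal f : measurable_fun setT f ->
  measurable_fun (@Rplus R) (fine_maximal f).
Proof.
by move=> mf; apply: measurableT_comp => //; exact: measurable_maximal_rearrangement.
Qed.

Let RplusP (t : R) : @Rplus R t -> (0 < t)%R.
Proof. by rewrite /Rplus/= in_itv/= andbT. Qed.

Lemma Ynorm_lty f : Ynorm mu NV f < +oo ->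
  {ae lebesgue_measure, forall t, @Rplus R t ->
    maximal_rearrangement mu f t \is a fin_num} /\
  Ynorm mu NV f = NV (fun t => fine (maximal_rearrangement mu f t)).
Proof. by rewrite /Ynorm /ext_norm; case: asboolP => // H; rewrite ltxx. Qed.

(** The main way to bound this norm: a real-valued majorant of [f^**] both makes it a.e. finite, so
    that [ext_norm] is not [+oo] by default, and allows the lattice property of [V]. *)
Lemma Ynorm_le f (h : R -> R) : measurable_fun setT f ->
  measurable_fun (@Rplus R) h ->
  {ae lebesgue_measure, forall t, @Rplus R t ->
    maximal_rearrangement mu f t <= (h t)%:E} ->
  Ynorm mu NV f <= NV h.
Proof.
move=> mf mh fh.
have fin : {ae lebesgue_measure, forall t, @Rplus R t ->
    maximal_rearrangement mu f t \is a fin_num}.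
  apply: filterS fh => t + t0 => /(_ t0) ft.
  rewrite ge0_fin_numE ?(le_lt_trans ft) ?ltry//.
  by apply: maximal_rearrangement_ge0; exact: RplusP.
rewrite /Ynorm /ext_norm; case: asboolP => // _.
apply: (bfs_lattice V_bfs) => //; first exact: measurable_fine_maximal.
apply: filterS2 fin fh => t ffin fht t0.
have f0 : 0 <= maximal_rearrangement mu f t.
  by apply: maximal_rearrangement_ge0; exact: RplusP.
rewrite ger0_norm ?fine_ge0//; apply: le_trans (ler_norm _).
by rewrite -lee_fin fineK ?ffin ?fht.
Qed.

Lemma Ynorm_ge0 f : measurable_fun setT f -> 0 <= Ynorm mu NV f.
Proof.
move=> mf; rewrite /Ynorm /ext_norm; case: asboolP => // _.
by apply: (bfs_ge0 V_bfs); exact: measurable_fine_maximal.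
Qed.

Lemma Ynorm_eq0 f : measurable_fun setT f ->
  Ynorm mu NV f = 0 <-> {ae mu, forall x, f x = 0%R}.
Proof.
move=> mf; split => [N0|f0].
  have [|fin NE] := @Ynorm_lty f; first by rewrite N0 ltry.
  have /(bfs_definite V_bfs) : NV (fine_maximal f) = 0 by rewrite -N0.
  move=> /(_ (measurable_fine_maximal mf)) fine0.
  have : {ae lebesgue_measure, forall t, @Rplus R t ->
      maximal_rearrangement mu f t = 0}.
    apply: filterS2 fin fine0 => t ft ft0 t0.
    by rewrite -(fineK (ft t0)) -/(fine_maximal f t) (ft0 t0).
  (* Vanishing of [f^**] at one point already gives [f = 0] a.e. *)
  by move=> /ae_Rplus_exists[t t0 /(maximal_rearrangement_eq0 mu mf t0)].
apply/eqP; rewrite eq_le Ynorm_ge0// andbT -(bfs0 V_bfs).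
apply: Ynorm_le => //; apply: aeW => t /RplusP t0.
by rewrite (maximal_rearrangement_eq0 mu mf t0).2.
Qed.

Lemma YnormZ (c : R) f : measurable_fun setT f ->
  Ynorm mu NV (fun x => c * f x)%R = `|c|%:E * Ynorm mu NV f.
Proof.
(* The scaling of [f^**] requires [c != 0]; for [c = 0] the convention [0 * +oo = 0] covers [f]
   outside [Y]. *)
move=> mf; have [->|c0] := eqVneq c 0%R.
  rewrite normr0 mul0e; apply/Ynorm_eq0; first exact: measurable_funM.
  by apply: aeW => x; rewrite mul0r.
have c_gt0 : (0 < `|c|)%R by rewrite normr_gt0.
rewrite /Ynorm /ext_norm.
have cE t : maximal_rearrangement mu (fun x => c * f x)%R t =
  `|c|%:E * maximal_rearrangement mu f t by exact: maximal_rearrangementZ.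
have finE t : (maximal_rearrangement mu (fun x => c * f x)%R t \is a fin_num) =
    (maximal_rearrangement mu f t \is a fin_num).
  rewrite cE; case: (maximal_rearrangement mu f t) => [r| |] //.
    by rewrite gt0_muley ?lte_fin.
  by rewrite gt0_muleNy ?lte_fin.
have -> : `[< {ae lebesgue_measure, forall t, @Rplus R t ->
      maximal_rearrangement mu (fun x => c * f x)%R t \is a fin_num} >] =
    `[< {ae lebesgue_measure, forall t, @Rplus R t ->
      maximal_rearrangement mu f t \is a fin_num} >].
  by apply: asbool_equiv_eq; split; apply: filterS => t; rewrite finE.
case: asboolP => _; last by rewrite gt0_muley ?lte_fin.
have := bfs_homogeneous V_bfs `|c|%R (measurable_fine_maximal mf).
rewrite normr_id => <-; congr NV; apply/funext => t; rewrite cE /fine_maximal.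
(* At infinite values [fine] returns 0 on both sides, so the functions agree everywhere. *)
case: (maximal_rearrangement mu f t) => [r| |] //=.
  by rewrite gt0_muley ?lte_fin//= mulr0.
by rewrite gt0_muleNy ?lte_fin//= mulr0.
Qed.

Lemma YnormD f g : measurable_fun setT f -> measurable_fun setT g ->
  Ynorm mu NV (fun x => f x + g x)%R <= Ynorm mu NV f + Ynorm mu NV g.
Proof.
move=> mf mg.
have [Nf|] := ltP (Ynorm mu NV f) +oo; last first.
  rewrite leye_eq => /eqP ->; rewrite addye ?leey// gt_eqF//.
  exact: lt_le_trans ltNy0 (Ynorm_ge0 _).
have [Ng|] := ltP (Ynorm mu NV g) +oo; last first.
  rewrite leye_eq => /eqP ->; rewrite addey ?leey// gt_eqF//.
  exact: lt_le_trans ltNy0 (Ynorm_ge0 _).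
have [ffin ->] := Ynorm_lty Nf; have [gfin ->] := Ynorm_lty Ng.
have mF := measurable_fine_maximal mf; have mG := measurable_fine_maximal mg.
apply: le_trans (bfs_triangle V_bfs mF mG); apply: Ynorm_le.
- exact: measurable_funD.
- exact: measurable_funD.
apply: filterS2 ffin gfin => t ft gt t0.
rewrite EFinD !fineK ?ft ?gt//; apply: maximal_rearrangement_le_add => //.
- exact: measurable_funD.
- exact: RplusP.
- by apply: aeW => x; exact: ler_normD.
Qed.

Lemma Ynorm_lattice f g : measurable_fun setT f -> measurable_fun setT g ->
  {ae mu, forall x, (`|f x| <= `|g x|)%R} -> Ynorm mu NV f <= Ynorm mu NV g.
Proof.
move=> mf mg fg.
have [Ng|] := ltP (Ynorm mu NV g) +oo; last by rewrite leye_eq => /eqP ->; rewrite leey.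
have [gfin ->] := Ynorm_lty Ng.
apply: Ynorm_le => //; first exact: measurable_fine_maximal.
apply: filterS gfin => t gt t0; rewrite fineK ?gt//.
by apply: maximal_rearrangement_le => //; exact: RplusP.
Qed.

(** On the set [E] of divergence the series dominates every multiple [n + 1] of the indicator, so
    [(n + 1) (1_E)^**(t)] stays below one finite constant; hence [(1_E)^**(t) = 0] and [E] is
    null. *)
Lemma ae_summable (g : nat -> X -> R) t : (forall k, measurable_fun setT (g k)) ->
  (0 < t)%R -> \sum_(k <oo) maximal_rearrangement mu (g k) t < +oo ->
  {ae mu, forall x, \sum_(k <oo) `|g k x|%:E < +oo}.
Proof.
move=> mg t0 gfin; set C := (X in X < _) in gfin.
pose E := [set x | +oo <= \sum_(k <oo) `|g k x|%:E].
have msum : measurable_fun setT (fun x => \sum_(k <oo) `|g k x|%:E).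
  apply: ge0_emeasurable_sum => // k _; apply/measurable_EFinP.
  exact: measurableT_comp.
have mE : measurable E.
  by rewrite -[E]setTI; exact: emeasurable_fun_c_infty.
have m1 : measurable_fun setT (\1_E : X -> R) by exact: measurable_indic.
suff /(maximal_rearrangement_eq0 mu m1 t0) : maximal_rearrangement mu \1_E t = 0.
  apply: filterS => x; rewrite indicE; case: (boolP (x \in E)) => [_ /eqP|].
    by rewrite oner_eq0.
  by rewrite notin_setE => /negP + _; rewrite ltNge.
have le_C (n : nat) : n.+1%:R%:E * maximal_rearrangement mu \1_E t <= C.
  have n0 : (n.+1%:R != 0 :> R)%R by rewrite pnatr_eq0.
  rewrite -[X in X%:E * _]ger0_norm// -maximal_rearrangementZ//.
  apply: maximal_rearrangement_series => //; first exact: measurable_funM.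
  apply: aeW => x; rewrite indicE; case: (boolP (x \in E)) => [/set_mem|_].
    by rewrite /E/= leye_eq => /eqP ->; rewrite leey.
  by rewrite mulr0 normr0; exact: nneseries_ge0.
have a0 : 0 <= maximal_rearrangement mu \1_E t by exact: maximal_rearrangement_ge0.
have C0 : 0 <= C by apply: nneseries_ge0 => k _ _; exact: maximal_rearrangement_ge0.
have Cfin : C \is a fin_num by rewrite ge0_fin_numE.
move: a0 le_C; case: (maximal_rearrangement mu \1_E t) => [a| |] // a0 le_C.
  apply/eqP; rewrite eq_le a0 andbT lee_fin leNgt; apply/negP => a_gt0.
  have := le_C (Num.bound (fine C / a)); rewrite -(fineK Cfin) -EFinM lee_fin.
  apply/negP; rewrite -ltNge -ltr_pdivrMr//.
  have Ca0 : (0 <= fine C / a)%R by rewrite divr_ge0 ?fine_ge0// ltW.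
  by apply: lt_trans (archi_boundP Ca0) _; rewrite ltr_nat.
by move: (le_C 0%N); rewrite mul1e leye_eq => /eqP; move: gfin => /[swap] ->.
Qed.

Lemma Ynorm_geometric_series (g : nat -> X -> R) :
  (forall k, measurable_fun setT (g k)) ->
  (forall k, Ynorm mu NV (g k) <= (2 ^- k)%:E) ->
  exists2 f : X -> R, measurable_fun setT f &
    Ynorm mu NV (fun x => \sum_(k < m) g k x - f x)%R @[m --> \oo] --> 0.
Proof.
move=> mg Ng.
have Nlt k : Ynorm mu NV (g k) < +oo by rewrite (le_lt_trans (Ng k))// ltry.
have gfin : {ae lebesgue_measure, forall t, forall k, @Rplus R t ->
    maximal_rearrangement mu (g k) t \is a fin_num}.
  by apply/ae_foralln => k; have [] := Ynorm_lty (Nlt k).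
pose G k t : R := fine_maximal (g k) t.
have mG k : measurable_fun (@Rplus R) (G k) by exact: measurable_fine_maximal.
have G0 k t : @Rplus R t -> (0 <= G k t)%R.
  by move=> /RplusP t0; rewrite fine_ge0// maximal_rearrangement_ge0.
have NG k : NV (G k) <= (2 ^- k)%:E by have [_ <-] := Ynorm_lty (Nlt k).
have [h [[mh _] Gh hcvg]] :=
  bfs_geometric_series V_bfs mG G0 NG.
(* A finite block of terms from [m] on is a difference of partial sums, at most [h] minus the [m]-th
   one; the number of terms then tends to infinity. *)
have tail_le : {ae lebesgue_measure, forall t, @Rplus R t -> forall m,
    \sum_(k <oo) maximal_rearrangement mu (g (k + m)%N) t <=
    (h t - \sum_(k < m) G k t)%:E}.
  apply: filterS2 gfin Gh => t gt Gt t0 m.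
  have M0 k : 0 <= maximal_rearrangement mu (g k) t.
    by apply: maximal_rearrangement_ge0; exact: RplusP.
  apply: lime_le; first by apply: is_cvg_nneseries => k _ _.
  apply: nearW => n; rewrite big_mkord.
  have -> : \sum_(k < n) maximal_rearrangement mu (g (k + m)%N) t =
      (\sum_(k < n) G (m + k)%N t)%:E.
    by rewrite -sumEFin; apply: eq_bigr => k _; rewrite addnC fineK ?gt.
  rewrite lee_fin lerBrDl; apply: le_trans (Gt t0 (m + n)%N).
  by rewrite big_split_ord.
pose A := [set x | \sum_(k <oo) `|g k x|%:E < +oo].
have mA : measurable A.
  rewrite -[A]setTI; apply: emeasurable_fun_infty_o => //.
  apply: ge0_emeasurable_sum => // k _; apply/measurable_EFinP.
  exact: measurableT_comp.
have aeA : {ae mu, forall x, A x}.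
  have /ae_Rplus_exists[t t0 /(_ 0%N) ht] := tail_le.
  apply: (@ae_summable g t) => //; apply: le_lt_trans (ltry (h t - \sum_(k < 0) G k t)%R).
  apply: le_trans ht; apply: lee_nneseries => // k _.
    by move=> _; exact: maximal_rearrangement_ge0.
  by rewrite addn0.
(* Cutting off outside the full-measure set [A] makes the series converge at every point, so its sum
   is measurable. *)
pose gA k x : R := (\1_A x * g k x)%R.
have gAA k x : A x -> gA k x = g k x.
  by move=> Ax; rewrite /gA indicE mem_set// mul1r.
have gAfin x : \sum_(k <oo) `|gA k x|%:E < +oo.
  have [Ax|nAx] := pselect (A x).
    by under eq_eseriesr do rewrite gAA//; exact: Ax.
  rewrite eseries0 ?ltry// => k _ _.
  by rewrite /gA indicE memNset// mul0r normr0.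
pose f x : R := limn (series (gA ^~ x)).
have mgA k : measurable_fun setT (gA k) by exact: measurable_funM.
have mf : measurable_fun setT f.
  apply: (@measurable_fun_cvg _ _ _ _ (fun m x => series (gA ^~ x) m)).
    by move=> m; rewrite /series/=; exact: measurable_sum.
  move=> x _; apply: normed_cvg.
  exact: (@nnseries_is_cvg _ (fun k => `|gA k x|%R)).
exists f => //.
have mS m : measurable_fun setT (fun x => \sum_(k < m) g k x - f x)%R.
  by apply: measurable_funB => //; exact: measurable_sum.
(* The [Y]-norm of the remainder lies between 0 and the [V]-norm of [h] minus the [m]-th partial
   sum, by subadditivity applied to the tail and [tail_le]. *)
apply: (squeeze_cvge _ (cvg_cst 0) hcvg).
apply: nearW => m; rewrite (Ynorm_ge0 (mS m))/=.
have mSG : measurable_fun (@Rplus R) (fun t => \sum_(k < m) G k t)%R.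
  by apply: (@measurable_sum _ _ _ _ _ _ (fun k : 'I_m => G k)) => k.
rewrite -(bfsN V_bfs (measurable_funB mSG mh)).
rewrite (_ : (fun t => - _)%R = (fun t => h t - \sum_(k < m) G k t)%R); last first.
  by apply/funext => t; rewrite /= opprB.
apply: Ynorm_le; [exact: mS|exact: (measurable_funB mh mSG)|].
apply: filterS tail_le => t ht t0; apply: le_trans (ht t0 m).
apply: maximal_rearrangement_series; [exact: mS|by []|exact: RplusP|].
apply: filterS aeA => x Ax.
have gE : gA ^~ x = g ^~ x by apply/funext => k; exact: gAA.
by rewrite /f gE; exact: series_tail_le.
Qed.

End Y.

Theorem proposition4p1 (R : realType) (d : measure_display)
    (X : measurableType d) (mu : {sigma_finite_measure set X -> \bar R})
    (mu_nontrivial : 0 < mu setT)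
    (NV : (R -> R) -> \bar R)
    (V_bfs : banach_function_space (@lebesgue_measure R) (@Rplus R) NV)
    (V_hardy : hardy_defined NV)
    (V_hardy_bounded : hardy_bounded NV) :
  banach_function_space mu setT (Ynorm mu NV) /\
  rearrangement_invariant mu (Ynorm mu NV).
Proof.
split; last first.
  (* The function [f^**] depends on [f] only through its tail function. *)
  by move=> f g _ _ fg; rewrite /Ynorm (eq_maximal_rearrangement fg).
split.
- by move=> f mf; exact: (Ynorm_ge0 mu V_bfs).
- move=> f mf; rewrite (Ynorm_eq0 mu V_bfs mf).
  by split; apply: filterS => x; [move=> -> | apply].
- by move=> c f mf; exact: (YnormZ mu V_bfs).
- by move=> f g mf mg; exact: (YnormD mu V_bfs).
- move=> f g mf mg fg; apply: (Ynorm_lattice V_bfs mf mg).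
  by apply: filterS fg => x; apply.
- apply: complete_of_geometric_series.
  + by move=> f mf; exact: (Ynorm_ge0 mu V_bfs).
  + move=> f mf; have := YnormZ mu V_bfs (-1) mf.
    rewrite normrN1 mul1e => <-; congr (Ynorm mu NV _).
    by apply/funext => x; rewrite mulN1r.
  + by move=> f g mf mg; exact: (YnormD mu V_bfs).
  + by move=> g mg Ng; exact: (Ynorm_geometric_series V_bfs mg Ng).
Qed.
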